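(* Let $M\subset\mathbb{R}^3$ be a smooth closed surface of genus zero with the metric induced from the Euclidean metric of $\mathbb{R}^3$, let $f:M\to\mathbb{S}^2$ be a conformal map to the round unit sphere, and let $h$ be its conformal factor, regarded as a positive function on $\mathbb{S}^2$ via $f^{-1}$. Consider $n\in\mathbb{N}$ distinct point vortices on $M$ with strengths $\omega_1,\dots,\omega_n\in\mathbb{R}$ satisfying $\sum_{i=1}^n\omega_i=0$, and let $p_1,\dots,p_n\in\mathbb{S}^2$ be their images under $f$. Then at every point of $M$ that is not a point vortex, with image $p\in\mathbb{S}^2\setminus\{p_1,\dots,p_n\}$ under $f$, the velocity of the fluid (as a tangent vector of $\mathbb{S}^2$ at $p$) is $$\vec u(p)=\frac{1}{4\pi h(p)^2}\sum_{i=1}^n\omega_i\,\frac{p\times p_i}{1-p\cdot p_i}.$$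
   Context: Conformal factor: if $\tilde g$ is the metric on $M$ and $g$ the round metric on $\mathbb{S}^2$, then $h>0$ is the function with $\tilde g_q(X,Y)=h(q)^2\,g_{f(q)}(d_fX,d_fY)$ for all $q\in M$, $X,Y\in T_qM$. A conformal map $M\to\mathbb{S}^2$ is smooth, angle preserving and (here) bijective; for $p\in\mathbb{S}^2$ we write $h(p)$ for $h(f^{-1}(p))$. Thus $M$ is identified with $\mathbb{S}^2$ carrying the metric $h^2g$. Symplectic gradients: for a function $F$ on $\mathbb{S}^2$ (round metric), $\operatorname{sgrad}_pF:=p\times\nabla_pF$, where $\nabla$ is the gradient on the round sphere and $p$ is the outer unit normal at $p$. With respect to the metric $h^2g$ the symplectic gradient is $\operatorname{sgrad}^*_pF:=\frac{1}{h(p)^2}\operatorname{sgrad}_pF$. Hamiltonian: let $G(x,y)=-\frac{1}{2\pi}\ln\!\left(\sin\!\left(\tfrac12\arccos(x\cdot y)\right)\right)$ for $x\ne y$ in $\mathbb{S}^2$. For any $m$ distinct point vortices $p_1,\dots,p_m\in\mathbb{S}^2$ with strengths $\omega_1,\dots,\omega_m$ of vanishing sum, the Hamiltonian of the point vortex system for the metric $h^2g$ is (theorem of Boatto and Koiller, taken as given) $$\tilde H(p_1,\dots,p_m)=-\sum_{i<j}\omega_i\omega_jG(p_i,p_j)-\frac{1}{4\pi}\sum_{i=1}^m\omega_i^2\log h(p_i).$$ Velocity of a vortex: the velocity of the $j$-th point vortex is $\vec u(p_j):=-\frac{1}{\omega_j}\operatorname{sgrad}^*_{p_j}\tilde H$,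 the symplectic gradient being taken in the variable $p_j$. This gradient is polynomial in the strengths and divisible by $\omega_j$; for $\omega_j=0$ the expression is understood after cancelling the factor $\omega_j$. Velocity of the fluid away from the vortices: the velocity at a point $p\notin\{p_1,\dots,p_n\}$ is the velocity of an additional passive point vortex $p_{n+1}=p$ of strength $\omega_{n+1}=0$ in the system of $n+1$ vortices. *)

(* Defs.v *)
From HB Require Import structures.
From mathcomp Require Import all_boot all_order all_algebra.
From mathcomp Require Import all_classical all_reals all_analysis.
Import Order.TTheory GRing.Theory Num.Theory.
Import numFieldNormedType.Exports.

Set Implicit Arguments.
Unset Strict Implicit.
Unset Printing Implicit Defensive.

Local Open Scope classical_set_scope.
Local Open Scope ring_scope.

Section EuclideanSpace.
Variable R : realType.
Implicit Types u v : 'rV[R]_3.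

Definition dot u v : R := \sum_(i < 3) u 0 i * v 0 i.

Definition cross u v : 'rV[R]_3 :=
  \row_(i < 3) (u 0 (i + 1) * v 0 (i + 2%:R) - u 0 (i + 2%:R) * v 0 (i + 1)).

Definition angle u v : R :=
  acos (dot u v / (Num.sqrt (dot u u) * Num.sqrt (dot v v))).

Definition sphere : set 'rV[R]_3 := [set x | dot x x = 1].

End EuclideanSpace.

Arguments sphere : clear implicits.

Section SmoothMaps.
Variable R : realType.

(* Only meaningful for open U. *)
Fixpoint Ck_on (V W : normedModType R) (k : nat) (U : set V) (f : V -> W) :
    Prop :=
  match k with
  | 0%N => forall x, U x -> {for x, continuous f}
  | k'.+1 => (forall x, U x -> differentiable f x) /\
             (forall v, Ck_on k' U (fun x => 'D_v f x : W))
  end.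

Definition smooth_on_open (V W : normedModType R) (U : set V) (f : V -> W) :=
  forall k, Ck_on k U f.

(* Smoothness on an arbitrary subset: near each point of A, f is the
   restriction of a smooth map defined on an open set. *)
Definition smooth_on (V W : normedModType R) (A : set V) (f : V -> W) :=
  forall x, A x -> exists (U : set V) (F : V -> W),
    [/\ open U, U x, smooth_on_open U F & {in A `&` U, F =1 f}].

Definition diffeomorphism (V W : normedModType R) (A : set V) (B : set W)
    (f : V -> W) :=
  [/\ set_bij A B f, smooth_on A f &
      exists2 g : W -> V, smooth_on B g & {in A, cancel f g}].

Definition homeomorphism (V W : normedModType R) (A : set V) (B : set W)
    (f : V -> W) :=
  [/\ set_bij A B f, {within A, continuous f} &
      exists2 g : W -> V, {within B, continuous g} & {in A, cancel f g}].

End SmoothMaps.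

Section Surfaces.
Variable R : realType.
Implicit Types (M S : set 'rV[R]_3) (f : 'rV[R]_3 -> 'rV[R]_3).

Definition smooth_surface M :=
  forall q, M q -> exists (W : set 'rV[R]_3) (U : set 'rV[R]_2)
      (phi : 'rV[R]_2 -> 'rV[R]_3),
    [/\ open W, W q, open U & diffeomorphism U (M `&` W) phi].

Definition closed_surface M := smooth_surface M /\ compact M.

Definition genus_zero M := exists phi, homeomorphism M (sphere R) phi.

(* Germs of smooth curves in S; the values of c far from 0 are irrelevant. *)
Definition curve_at S (p : 'rV[R]_3) (c : R -> 'rV[R]_3) :=
  c 0 = p /\ exists2 e : R, 0 < e &
    smooth_on_open (ball (0 : R) e) c /\ forall t, ball (0 : R) e t -> S (c t).

Definition velocity (c : R -> 'rV[R]_3) : 'rV[R]_3 := derive1 c 0.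

Definition tangent_space S p : set 'rV[R]_3 := velocity @` curve_at S p.

(* The differential of f at p: X = c'(0) is sent to (f o c)'(0).  For smooth f
   and X in the tangent space this does not depend on the curve c. *)
Definition differential S f p (X : 'rV[R]_3) : 'rV[R]_3 :=
  get [set Y | exists2 c, curve_at S p c & velocity c = X /\
                                           velocity (f \o c) = Y].

Definition angle_preserving M f :=
  forall q X Y, M q -> tangent_space M q X -> tangent_space M q Y ->
    X != 0 -> Y != 0 ->
    [/\ differential M f q X != 0, differential M f q Y != 0 &
        angle (differential M f q X) (differential M f q Y) = angle X Y].

Definition conformal_map M f :=
  [/\ smooth_on M f, set_bij M (sphere R) f & angle_preserving M f].

Definition conformal_factor M f (h : 'rV[R]_3 -> R) :=
  forall q, M q -> 0 < h q /\
    forall X Y, tangent_space M q X -> tangent_space M q Y ->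
      dot X Y =
        h q ^+ 2 * dot (differential M f q X) (differential M f q Y).

(* h o f^-1 on the sphere; the default 0 is never used for bijective f. *)
Definition on_sphere M f (h : 'rV[R]_3 -> R) : 'rV[R]_3 -> R :=
  h \o 'pinv_(fun=> 0) M f.

End Surfaces.

Section PointVortices.
Variable R : realType.
Implicit Types (h F : 'rV[R]_3 -> R) (x y p u s : 'rV[R]_3).

(* v is the gradient at p of F restricted to the round sphere. *)
Definition is_gradient F p (v : 'rV[R]_3) :=
  tangent_space (sphere R) p v /\
  forall c, curve_at (sphere R) p c ->
    is_derive (0 : R) 1 (F \o c) (dot v (velocity c)).

Definition is_sgrad F p s := exists2 v, is_gradient F p v & s = cross p v.

(* Symplectic gradient for the metric h^2 g. *)
Definition is_sgrad_star h F p s :=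
  exists2 v, is_sgrad F p v & s = (h p ^+ 2)^-1 *: v.

Definition green x y : R :=
  - (2%:R * pi)^-1 * ln (sin (2%:R^-1 * acos (dot x y))).

Definition hamiltonian h (m : nat) (w : 'I_m -> R) (p : 'I_m -> 'rV[R]_3) : R :=
  - (\sum_(i < m) \sum_(j < m | (i < j)%N) w i * w j * green (p i) (p j))
  - (4%:R * pi)^-1 * \sum_(i < m) w i ^+ 2 * ln (h (p i)).

(* u = - (1 / w_j) sgrad* H, with the factor w_j cancelled: as a function of
   the strength a of the j-th vortex (all other data being fixed) the
   symplectic gradient of H in p_j is a * Q(a) with Q polynomial, and
   u = - Q(w_j).  This determines u also when w_j = 0. *)
Definition is_vortex_velocity h (m : nat) (w : 'I_m -> R)
    (p : 'I_m -> 'rV[R]_3) (j : 'I_m) u :=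
  exists2 Q : 'rV[{poly R}]_3,
    (forall a : R,
       is_sgrad_star h (fun x => hamiltonian h (dfwith w j a) (dfwith p j x))
         (p j) (a *: map_mx (horner^~ a) Q)) &
    u = - map_mx (horner^~ (w j)) Q.

Definition append (T : Type) (n : nat) (s : 'I_n -> T) (x : T) : 'I_n.+1 -> T :=
  fun i => if unlift ord_max i is Some k then s k else x.

Definition is_fluid_velocity h (n : nat) (w : 'I_n -> R)
    (p : 'I_n -> 'rV[R]_3) x u :=
  is_vortex_velocity h (append w 0) (append p x) ord_max u.

End PointVortices.

(* Main.v *)
(* Along curves on the sphere, Green's function is -(4 pi)^-1 ln((1 - x.y)/2),
   so the symplectic gradient of its part of the Hamiltonian is explicit.  As a
   function of the strength a of the extra vortex the Hamiltonian is a constant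
   plus a linear term (the Green functions) plus a quadratic term in a, the
   latter a multiple of a^2 ln h.  After division by a only the linear term
   survives at a = 0, provided that ln h has a gradient at all.

   To see that it has one, write h in a chart Phi of M as the quotient of the
   lengths of a coordinate field and of its image under the differential of f.
   If c is a curve on the sphere, then the curve f^-1 o c is continuous because
   M is compact, and its chart expression u is differentiable because f o Phi is
   an immersion with (f o Phi) o u = c. *)

Require Import Defs.
From HB Require Import structures.
From mathcomp Require Import all_boot all_order all_algebra.
From mathcomp Require Import all_classical all_reals all_analysis.
From mathcomp Require Import ring lra.
Import Order.TTheory GRing.Theory Num.Theory.
Import numFieldNormedType.Exports.
Local Open Scope classical_set_scope.
Local Open Scope ring_scope.

Set Implicit Arguments.
Unset Strict Implicit.

(** * Algebra of the dot and cross products *)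

Section DotCross.
Variable R : realType.
Implicit Types p u v x y : 'rV[R]_3.

Lemma dotC u v : dot u v = dot v u.
Proof. by apply: eq_bigr => i _; rewrite mulrC. Qed.

Lemma dotDr u v x : dot u (v + x) = dot u v + dot u x.
Proof. by rewrite -big_split; apply: eq_bigr => i _; rewrite mxE mulrDr. Qed.

Lemma dotZr u a v : dot u (a *: v) = a * dot u v.
Proof. by rewrite big_distrr; apply: eq_bigr => i _; rewrite mxE mulrCA. Qed.

Lemma dotDl u v x : dot (u + v) x = dot u x + dot v x.
Proof. by rewrite !(dotC _ x) dotDr. Qed.

Lemma dotZl u a v : dot (a *: u) v = a * dot u v.
Proof. by rewrite !(dotC _ v) dotZr. Qed.

Lemma dotNr u v : dot u (- v) = - dot u v.
Proof. by rewrite -scaleN1r dotZr mulN1r. Qed.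

Lemma dotNl u v : dot (- u) v = - dot u v.
Proof. by rewrite !(dotC _ v) dotNr. Qed.

Lemma dot0r u : dot u 0 = 0.
Proof. by rewrite -(scale0r u) dotZr mul0r. Qed.

Lemma dot0l u : dot 0 u = 0.
Proof. by rewrite dotC dot0r. Qed.

Lemma dot_ge0 u : 0 <= dot u u.
Proof. by apply: sumr_ge0 => i _; rewrite -expr2 sqr_ge0. Qed.

Lemma dot_eq0 u : (dot u u == 0) = (u == 0).
Proof.
apply/eqP/eqP => [u0|->]; last exact: dot0l.
apply/rowP => i; rewrite mxE.
have /eqP : u 0 i * u 0 i = 0.
  apply/eqP; move: u0 => /eqP; rewrite psumr_eq0 => [|j _]; last first.
    by rewrite -expr2 sqr_ge0.
  by move/allP => /(_ i (mem_index_enum _)).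
by rewrite mulf_eq0 orbb => /eqP.
Qed.

Lemma dot_gt0 u : (0 < dot u u) = (u != 0).
Proof. by rewrite lt_def dot_eq0 dot_ge0 andbT. Qed.

Lemma crossD p u v : cross p (u + v) = cross p u + cross p v.
Proof. by apply/rowP => i; rewrite !mxE; ring. Qed.

Lemma crossZ p a v : cross p (a *: v) = a *: cross p v.
Proof. by apply/rowP => i; rewrite !mxE; ring. Qed.

Lemma crossN p v : cross p (- v) = - cross p v.
Proof. by rewrite -scaleN1r crossZ scaleN1r. Qed.

Lemma crossvv p : cross p p = 0.
Proof. by apply/rowP => i; rewrite !mxE; ring. Qed.

Lemma cross_sum p n (v : 'I_n -> 'rV[R]_3) :
  cross p (\sum_i v i) = \sum_i cross p (v i).
Proof.
apply: (big_morph (cross p) (crossD p)).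
by apply/rowP => i; rewrite !mxE; ring.
Qed.

Lemma dot_suml n (v : 'I_n -> 'rV[R]_3) x :
  dot (\sum_i v i) x = \sum_i dot (v i) x.
Proof.
exact: (big_morph (fun u => dot u x) (fun u v => dotDl u v x) (dot0l x)).
Qed.

(** For unit vectors the squared length of [x - y] is [2 - 2 * dot x y], and it is positive when the
    vectors differ. *)
Lemma sphere_dot_lt1 x y : sphere R x -> sphere R y -> x != y -> dot x y < 1.
Proof.
rewrite /sphere /= -subr_eq0 -dot_gt0 => xx yy.
by rewrite !(dotDl, dotDr, dotNl, dotNr) xx yy (dotC y x); lra.
Qed.

Lemma sphere_dot_bounds x y :
  sphere R x -> sphere R y -> -1 <= dot x y <= 1.
Proof.
rewrite /sphere /= => xx yy.
have := dot_ge0 (x - y); have := dot_ge0 (x + y).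
rewrite !(dotDl, dotDr, dotNl, dotNr) xx yy (dotC y x); lra.
Qed.

End DotCross.

(** * Smoothness along lines and derivatives along curves *)

Section Calculus.
Variable R : realType.

Lemma Ck_onS (V W : normedModType R) k (U U' : set V) (f : V -> W) :
  U' `<=` U -> Ck_on k U f -> Ck_on k U' f.
Proof.
move=> sub; elim: k f => [|k IH] f /= => [cf x /sub/cf //|[df Df]].
by split=> [x /sub/df //|v]; exact/IH/Df.
Qed.

(* Both sides are limits of the same difference quotient, so [phi] need not be
   differentiable. *)
Lemma derive_line (V W : normedModType R) (phi : V -> W) (a v : V) (s t : R) :
  'D_s (fun r : R => phi (r *: v + a)) t = 'D_(s *: v) phi (t *: v + a).
Proof.
rewrite /derive; set d := (fun h => _); set d' := (fun h => _).
suff -> : d = d' by [].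
apply/funext => h; rewrite /d /d' /=.
by rewrite !scalerDl -scalerA addrA.
Qed.

(** By [derive_line], differentiating a restriction to a line again gives a restriction to that
    line, of a directional derivative of [phi]; hence the induction over all [phi]. *)
Lemma Ck_on_line (V W : normedModType R) k (U : set V) (phi : V -> W)
    (a v : V) :
  Ck_on k U phi ->
  Ck_on k [set t : R | U (t *: v + a)] (fun t => phi (t *: v + a)).
Proof.
elim: k phi => [|k IH] phi /=.
  move=> cphi t /cphi ct; apply: (@continuous_comp _ _ _ _ phi) => //.
  apply: (@cvgD _ _ _ _ _ (fun t => t *: v) (cst a)); last exact: cvg_cst.
  exact: scalel_continuous.
move=> [dphi Dphi]; split=> [t /dphi dt|s].
  by apply: (@differentiable_comp _ _ _ _ _ phi).
have -> : 'D_s (fun t : R => phi (t *: v + a)) =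
    (fun t => 'D_(s *: v) phi (t *: v + a)).
  by apply/funext => t; exact: derive_line.
exact: IH (Dphi _).
Qed.

Lemma is_derive_comp_curve (V W : normedModType R) (K : V -> W) (c : R -> V)
    (t : R) (v : V) :
  differentiable K (c t) -> is_derive t 1 c v ->
  is_derive t 1 (K \o c) ('d K (c t) v).
Proof.
move=> dK [/derivable1_diffP dc <-].
have dKc : differentiable (K \o c) t by exact: differentiable_comp.
split; first exact/derivable1_diffP.
by rewrite !deriveE// diff_comp.
Qed.

Lemma is_derive_coord n (c : R -> 'rV[R]_n) (t : R) (v : 'rV[R]_n) (i : 'I_n) :
  is_derive t 1 c v -> is_derive t 1 (fun s => c s 0 i) (v 0 i).
Proof.
move=> [dc <-]; split; first exact: (derivable_mxP _ _ _).1.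
by rewrite derive_mx// mxE.
Qed.

Lemma is_derive_dot (y : 'rV[R]_3) (c : R -> 'rV[R]_3) (t : R) (v : 'rV[R]_3) :
  is_derive t 1 c v -> is_derive t 1 (fun s => dot y (c s)) (dot y v).
Proof.
move=> dc; rewrite /dot.
have h i : is_derive t 1 (fun s => y 0 i * c s 0 i) (y 0 i * v 0 i).
  exact/is_deriveZ/is_derive_coord.
have := is_derive_sum h.
by congr is_derive; apply/funext => s; rewrite fct_sumE.
Qed.

Lemma is_derive_dotself (c : R -> 'rV[R]_3) (t : R) (v : 'rV[R]_3) :
  is_derive t 1 c v ->
  is_derive t 1 (fun s => dot (c s) (c s)) (2 * dot (c t) v).
Proof.
move=> dc; rewrite /dot.
have h i : is_derive t 1 (fun s => c s 0 i * c s 0 i) (2 * (c t 0 i * v 0 i)).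
  have di := is_derive_coord i dc.
  apply: is_derive_eq (is_deriveM di di) _.
  by rewrite /GRing.scale/=; ring.
have := is_derive_sum h; rewrite -big_distrr/=.
by congr is_derive; apply/funext => s; rewrite fct_sumE.
Qed.

(* Continuity of the curve replaces the inverse function theorem. *)
Lemma is_derive_of_comp (V : normedModType R) (Psi : V -> V) (u : R -> V)
    (b : V) :
  is_diff (u 0) Psi id -> {for 0, continuous u} ->
  is_derive (0 : R) 1 (Psi \o u) b -> is_derive (0 : R) 1 u b.
Proof.
move=> dPsi cu [dv vb].
suff cvgb : (fun h => h^-1 *: ((u \o shift 0) (h *: 1) - u 0)) @ 0^' --> b.
  by split; [apply/cvg_ex; exists b|exact: cvg_lim].
have cD : (fun h => h^-1 *: ((Psi \o u \o shift 0) (h *: 1) - (Psi \o u) 0))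
    @ 0^' --> b by rewrite -vb; exact: dv.
have b1 : 0 < `|b| + 1 by rewrite ltr_wpDl.
apply/cvgrPdist_le => e e0.
(* The bound by one half lets [eps * |q|] be absorbed into [|q|], which gives
   [|q| <= 2 * (|b| + 1)]; the other bound then makes [eps * |q|] at most [e / 2]. *)
pose eps := Num.min 2^-1 (e / (4 * (`|b| + 1))).
have eps0 : 0 < eps by rewrite lt_min invr_gt0 ltr0n divr_gt0// mulr_gt0.
have /eqaddoP/(_ _ eps0) := diff_locally (@ex_diff _ _ _ _ _ _ _ dPsi).
rewrite diff_val => near_o.
(* As the differential of [Psi] is the identity, [Psi] moves increments near [u 0] by a small
   relative error only; continuity of [u] carries this over to the parameter. *)
have near_u : \forall h \near 0^',
    `|Psi (u h) - Psi (u 0) - (u h - u 0)| <= eps * `|u h - u 0|.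
  apply: nbhs_dnbhs.
  have cu0 : (fun h => u h - u 0) @ 0 --> 0.
    by rewrite -(subrr (u 0)); apply: cvgB => //; exact: cvg_cst.
  have := cu0 _ near_o; rewrite nbhs_simpl/=; apply: filterS => h /=.
  by rewrite !fctE /= subrK opprD addrA.
near=> h.
have h0 : h != 0 by near: h; exact: nbhs_dnbhs_neq.
have ih0 : 0 <= `|h^-1| by [].
have Db : `|b - h^-1 *: (Psi (u h) - Psi (u 0))| <= Num.min 1 (e / 2).
  near: h; move/cvgrPdist_le: cD => /(_ (Num.min 1 (e / 2))).
  rewrite lt_min ltr01 divr_gt0// => /(_ isT); apply: filterS => h.
  by rewrite /= addr0 [h%:A]mulr1.
have uh : `|Psi (u h) - Psi (u 0) - (u h - u 0)| <= eps * `|u h - u 0|.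
  by near: h.
rewrite /= addr0 [h%:A]mulr1.
set D := h^-1 *: (Psi (u h) - Psi (u 0)) in Db.
set q := h^-1 *: (u h - u 0).
have Dq : `|D - q| <= eps * `|q|.
  by rewrite -scalerBr !normrZ mulrCA ler_wpM2l.
move: Db; rewrite le_min => /andP[Db1 Db2].
have epsl : eps <= 2^-1 by rewrite ge_min lexx.
have epsr : eps * (4 * (`|b| + 1)) <= e.
  by rewrite -ler_pdivlMr ?mulr_gt0// ge_min lexx orbT.
have nD : `|D| <= `|b| + 1.
  rewrite -(subrK b D) (le_trans (ler_normD _ _))// addrC lerD2l.
  by rewrite distrC.
have nq : `|q| <= `|D| + `|D - q|.
  by rewrite -{1}(subKr D q) (le_trans (ler_normB _ _)).
have nbq : `|b - q| <= `|b - D| + `|D - q|.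
  by rewrite -(subrKA D) ler_normD.
have q0 : 0 <= `|q| by [].
have : eps * `|q| <= 2^-1 * `|q| by rewrite ler_wpM2r.
have : eps * `|q| <= eps * (2 * (`|b| + 1)).
  rewrite ler_wpM2l ?(ltW eps0)//.
  have : eps * `|q| <= 2^-1 * `|q| by rewrite ler_wpM2r.
  lra.
lra.
Unshelve. all: by end_near. Qed.

End Calculus.

(** * Tangent vectors and gradients on the round sphere *)

Section SphereCalculus.
Variable R : realType.

Lemma curve_at_derive S (p : 'rV[R]_3) c :
  curve_at S p c -> is_derive (0 : R) 1 c (velocity c).
Proof.
move=> [_ [e e0 [sc _]]]; have [dc _] := sc 1%N.
split; last by rewrite /velocity derive1E.
exact/derivable1_diffP/dc/ballxx.
Qed.

Lemma curve_at_near S (p : 'rV[R]_3) c :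
  curve_at S p c -> \forall t \near (0 : R), S (c t).
Proof.
move=> [_ [e e0 [_ Sc]]]; near=> t; apply: Sc; near: t.
exact: nbhsx_ballx.
Unshelve. all: by end_near. Qed.

Definition circle (A B : 'rV[R]_3) (a t : R) :=
  cos (a * t) *: A + sin (a * t) *: B.

Lemma is_derive_circle A B (a t : R) :
  is_derive t 1 (circle A B a) (circle (a *: B) (- a *: A) a t).
Proof.
have dl : is_derive t 1 (fun t => a * t) a.
  by apply: is_derive_eq (is_deriveZ a (is_derive_id _ _)) _; exact: mulr1.
have dc : is_derive t 1 (fun t => cos (a * t)) (- a * sin (a * t)).
  have h := @is_derive1_comp _ cos (fun t : R => a * t) t _ _
    (is_derive_cos _) dl.
  by apply: (is_derive_eq h); ring.
have ds : is_derive t 1 (fun t => sin (a * t)) (a * cos (a * t)).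
  have h := @is_derive1_comp _ sin (fun t : R => a * t) t _ _
    (is_derive_sin _) dl.
  by apply: (is_derive_eq h); ring.
have dZ (f : R -> R) (df : R) (C : 'rV[R]_3) :
    is_derive t 1 f df -> is_derive t 1 (fun t => f t *: C) (df *: C).
  move=> [/derivable1_diffP h <-].
  have hC : differentiable (fun t => f t *: C) t by exact: differentiableZl.
  split; first exact/derivable1_diffP.
  by rewrite !deriveE// diffZl.
apply: (is_derive_eq (is_deriveD (dZ _ _ A dc) (dZ _ _ B ds))).
by rewrite /circle !scalerA addrC; congr (_ *: _ + _ *: _); ring.
Qed.

Lemma smooth_circle (U : set R) A B a : smooth_on_open U (circle A B a).
Proof.
move=> k; elim: k A B => [|k IH] A B /=.
  move=> x _; apply/differentiable_continuous/derivable1_diffP.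
  by have [] := is_derive_circle A B a x.
have dc A' B' x : differentiable (circle A' B' a) x.
  by apply/derivable1_diffP; have [] := is_derive_circle A' B' a x.
split=> // v.
have -> : 'D_v (circle A B a) = circle ((v * a) *: B) (- (v * a) *: A) a.
  apply/funext => x; rewrite deriveE// -[X in 'd _ _ X]mulr1 linearZ/=.
  rewrite -deriveE// (@derive_val _ _ _ _ _ _ _ (is_derive_circle A B a x)).
  by rewrite /circle scalerDr !scalerA; congr (_ *: _ + _ *: _); ring.
exact: IH.
Qed.

(** One direction differentiates [dot (c s) (c s) = 1]; the other runs along the great circle
    through [p] in the direction [v]. *)
Lemma tangent_sphereP (p v : 'rV[R]_3) : sphere R p ->
  tangent_space (sphere R) p v <-> dot p v = 0.
Proof.
move=> pp; split=> [[c cc <-]|pv].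
  have [c0 _] := cc.
  have := is_derive_dotself (curve_at_derive cc); rewrite c0 => -[_ dd].
  have : 'D_1 (fun s => dot (c s) (c s)) 0 = 'D_1 (cst 1 : R -> R) 0.
    by apply: near_eq_derive; exact: curve_at_near cc.
  by rewrite dd derive_cst; lra.
pose a := Num.sqrt (dot v v).
have a2 : a ^+ 2 = dot v v by rewrite sqr_sqrtr// dot_ge0.
(* The zero vector cannot be normalised; a constant curve realises it. *)
have [v0|v0] := eqVneq v 0.
  exists (circle p 0 0).
    split; first by rewrite /circle mulr0 cos0 sin0 scale1r scale0r addr0.
    exists 1 => //; split=> [|t _]; first exact: smooth_circle.
    by rewrite /circle mul0r cos0 sin0 scale1r scale0r addr0.
  rewrite /velocity derive1E.
  rewrite (@derive_val _ _ _ _ _ _ _ (is_derive_circle _ _ _ _)).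
  by rewrite /circle v0 oppr0 !scale0r !scaler0 addr0.
have a0 : a != 0 by rewrite gt_eqF// sqrtr_gt0 dot_gt0.
exists (circle p (a^-1 *: v) a).
  split; first by rewrite /circle mulr0 cos0 sin0 scale1r scale0r addr0.
  exists 1 => //; split=> [|t _]; first exact: smooth_circle.
  rewrite /sphere/= /circle !(dotDl, dotDr, dotZl, dotZr) pp pv (dotC v p) pv.
  rewrite -a2 -[RHS](cos2Dsin2 (a * t)); field.
  exact: a0.
rewrite /velocity derive1E.
rewrite (@derive_val _ _ _ _ _ _ _ (is_derive_circle _ _ _ _)).
rewrite /circle mulr0 cos0 sin0 scale1r scale0r addr0 scalerA mulfV//.
exact: scale1r.
Qed.

(** The difference [v - w] is itself tangent, so testing both gradients along a curve with this
    velocity shows that its length is zero. *)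
Lemma gradient_unique F (p v w : 'rV[R]_3) : sphere R p ->
  is_gradient F p v -> is_gradient F p w -> v = w.
Proof.
move=> pp [/(tangent_sphereP _ pp) tv gv] [/(tangent_sphereP _ pp) tw gw].
apply/eqP; rewrite -subr_eq0 -dot_eq0.
have /(tangent_sphereP _ pp)[c cc cE] : dot p (v - w) = 0.
  by rewrite dotDr dotNr tv tw subrr.
have [_ dv] := gv _ cc; have [_ dw] := gw _ cc.
by rewrite -{2}cE dotDl dotNl -dv -dw subrr.
Qed.

(** The combination has the shape of the Hamiltonian as a function of the position of one added
    vortex. *)
Lemma is_gradient_lin F G (p v w : 'rV[R]_3) (k a b : R) : sphere R p ->
  is_gradient F p v -> is_gradient G p w ->
  is_gradient (fun x => k + a * F x + b * G x) p (a *: v + b *: w).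
Proof.
move=> pp [tv gv] [tw gw]; split.
  apply/(tangent_sphereP _ pp); rewrite dotDr !dotZr.
  rewrite ((tangent_sphereP _ pp).1 tv) ((tangent_sphereP _ pp).1 tw).
  by rewrite !mulr0 addr0.
move=> c cc; rewrite dotDl !dotZl.
have h := is_deriveD (is_deriveD (is_derive_cst k (0 : R) 1)
  (is_deriveZ a (gv c cc))) (is_deriveZ b (gw c cc)).
by apply: (is_derive_eq h); rewrite add0r.
Qed.

Lemma is_gradient_sum n (F : 'I_n -> 'rV[R]_3 -> R) (p : 'rV[R]_3) v :
  sphere R p -> (forall i, is_gradient (F i) p (v i)) ->
  is_gradient (fun x => \sum_i F i x) p (\sum_i v i).
Proof.
move=> pp gF; split.
  apply/(tangent_sphereP _ pp); rewrite dotC dot_suml big1// => i _.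
  by rewrite dotC; apply/(tangent_sphereP _ pp); have [] := gF i.
move=> c cc; rewrite dot_suml.
have := is_derive_sum (fun i => (gF i).2 c cc).
by congr is_derive; apply/funext => s; rewrite fct_sumE.
Qed.

(** * Green's function on the sphere and its gradient *)

Lemma sin_half_acos (t : R) : -1 <= t <= 1 ->
  sin (2^-1 * acos t) = Num.sqrt ((1 - t) / 2).
Proof.
move=> t1; have [/andP[a0 api] ct] := acos_def t1.
(* The half angle lies between 0 and [pi / 2], so its sine is determined by its square, which the
   double angle formula gives. *)
have : 0 <= sin (2^-1 * acos t).
  by apply: sin_ge0_pi; have := pi_ge0 R; lra.
move=> /ger0_norm <-; rewrite -sqrtr_sqr; congr Num.sqrt.
have := cos_mulr2n (2^-1 * acos t).
have -> : 2^-1 * acos t *+ 2 = acos t by rewrite -mulr_natl; field.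
by rewrite ct mulr2n; have := cos2Dsin2 (2^-1 * acos t); lra.
Qed.

Lemma ln_sqrt (t : R) : 0 < t -> ln (Num.sqrt t) = 2^-1 * ln t.
Proof.
move=> t0; rewrite -[in RHS](@sqr_sqrtr _ t) ?ltW// lnXn ?sqrtr_gt0//.
by move: (ln _) => l; field.
Qed.

(* Replacing sin (acos t / 2) by sqrt ((1 - t) / 2) keeps the formula
   differentiable at the antipode of [y], where [acos] is not. *)
Lemma greenE (x y : 'rV[R]_3) : sphere R x -> sphere R y -> x != y ->
  green x y = - (4 * pi)^-1 * ln ((1 - dot x y) / 2).
Proof.
move=> sx sy xy; rewrite /green sin_half_acos ?sphere_dot_bounds//.
rewrite ln_sqrt; last by have := sphere_dot_lt1 sx sy xy; lra.
by move: (pi : R) (lt0r_neq0 (pi_gt0 R)) => P P0; field.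
Qed.

(** Differentiating the logarithm gives a multiple of [y]; its component along [p] is removed to
    make it tangent, without effect on the products with tangent vectors. *)
Lemma is_gradient_green (y p : 'rV[R]_3) : sphere R y -> sphere R p -> p != y ->
  is_gradient (green y) p
    ((4 * pi * (1 - dot p y))^-1 *: (y - dot p y *: p)).
Proof.
move=> sy sp py; have lt1 := sphere_dot_lt1 sp sy py.
split.
  apply/(tangent_sphereP _ sp).
  by rewrite dotZr dotDr dotNr dotZr sp mulr1 subrr mulr0.
move=> c cc; have [c0 _] := cc.
have pv : dot p (velocity c) = 0.
  by apply/(tangent_sphereP _ sp); exists c.
have dc := curve_at_derive cc.
pose L t := - (4 * pi)^-1 * ln ((1 - dot y (c t)) / 2).
have d1 : is_derive (0 : R) 1 (fun t => (1 - dot y (c t)) / 2)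
    (- dot y (velocity c) / 2).
  have h := is_deriveZ 2^-1
    (is_deriveB (is_derive_cst (1 : R) (0 : R) 1) (is_derive_dot y dc)).
  have -> : (fun t => (1 - dot y (c t)) / 2) =
      2^-1 \*: (cst 1 - (fun t => dot y (c t))).
    by apply/funext => t; rewrite mulrC.
  by apply: (is_derive_eq h); rewrite sub0r mulrC.
have pos0 : 0 < (1 - dot y (c 0)) / 2 by rewrite c0 dotC; lra.
have dL : is_derive (0 : R) 1 L
    (dot ((4 * pi * (1 - dot p y))^-1 *: (y - dot p y *: p)) (velocity c)).
  have h := is_deriveZ (- (4 * pi)^-1) (@is_derive1_comp _ (@ln R)
    (fun t => (1 - dot y (c t)) / 2) 0 _ _ (is_derive1_ln pos0) d1).
  apply: (is_derive_eq h).
  rewrite c0 (dotC y p) !(dotDl, dotZl, dotNl) pv /GRing.scale/=.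
  have d0 : 1 - dot p y != 0 by apply: lt0r_neq0; lra.
  move: (pi : R) (lt0r_neq0 (pi_gt0 R)) => P P0.
  by field; rewrite P0 d0.
have cd1 : {for (0 : R), continuous (fun t => (1 - dot y (c t)) / 2)}.
  by apply/differentiable_continuous/derivable1_diffP; have [] := d1.
(* The closed form [L] is valid only while the curve is on the sphere and away from [y]; positivity
   of the argument of the logarithm ensures the latter near 0. *)
apply: near_eq_is_derive dL.
near=> t.
rewrite /L /= greenE//.
- by near: t; exact: curve_at_near cc.
- have : 0 < (1 - dot y (c t)) / 2.
    by near: t; exact: (cvgr_gt _ cd1 _ pos0).
  by apply: contraTneq => <-; rewrite sy subrr mul0r ltxx.
Unshelve. all: by end_near. Qed.

End SphereCalculus.

(** * Charts of the surface and differentiability of the conformal factor *)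

Section ConformalFactor.
Variable R : realType.

Lemma smooth_on_continuous (V W : normedModType R) (A : set V) (f : V -> W) :
  smooth_on A f -> {within A, continuous f}.
Proof.
move=> sf; apply/subspace_continuousP => x Ax.
have [U [F [oU Ux sF Ff]]] := sf x Ax.
have FE y : A y -> U y -> F y = f y by move=> Ay Uy; apply: Ff; rewrite inE.
have cF : F @ within A (nbhs x) --> f x.
  by rewrite -FE//; apply: cvg_within_filter; exact: (sF 0%N).
apply: cvg_trans cF; apply: near_eq_cvg; rewrite near_withinE.
by near=> y => Ay; apply/FE => //; near: y; exact: open_nbhs_nbhs.
Unshelve. all: by end_near. Qed.

(** By the chain rule for the extension [F], every curve with velocity [X] gives the same image, so
    [get] chooses from a singleton. *)
Lemma differential_ext (M W : set 'rV[R]_3) (f F : 'rV[R]_3 -> 'rV[R]_3) q X :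
  open W -> W q -> differentiable F q -> {in M `&` W, F =1 f} ->
  tangent_space M q X -> differential M f q X = 'd F q X.
Proof.
move=> oW Wq dF Ff.
have vE c : curve_at M q c -> velocity (f \o c) = 'd F q (velocity c).
  move=> cc; have [c0 _] := cc; have dc := curve_at_derive cc.
  have dFc0 : differentiable F (c 0) by rewrite c0.
  have /(@derive_val _ _ _ _ _ _ _) := is_derive_comp_curve dFc0 dc.
  rewrite c0 => <-; rewrite {1}/velocity derive1E; apply: near_eq_derive.
  have [dcc _] := dc.
  have cc0 : {for 0, continuous c}.
    exact/differentiable_continuous/derivable1_diffP.
  near=> t; apply/esym/Ff; rewrite inE; split.
    by near: t; exact: curve_at_near cc.
  by near: t; apply: cc0; rewrite c0; exact: open_nbhs_nbhs.
case=> c cc <-; apply: get_unique.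
  by exists c => //; split=> //; exact: vE.
by move=> Y [d dd [dE <-]]; rewrite vE// dE.
Unshelve. all: by end_near. Qed.

(** The image under the chart of the line through [u] in direction [v] is a curve with the required
    velocity. *)
Lemma tangent_chart (M : set 'rV[R]_3) (U : set 'rV[R]_2)
    (Phi : 'rV[R]_2 -> 'rV[R]_3) u v :
  open U -> U u -> smooth_on_open U Phi -> (forall y, U y -> M (Phi y)) ->
  tangent_space M (Phi u) ('D_v Phi u).
Proof.
move=> oU Uu sPhi MPhi.
exists (fun t : R => Phi (t *: v + u)); last first.
  by rewrite /velocity derive1E derive_line scale1r scale0r add0r.
split; first by rewrite scale0r add0r.
have cl : {for (0 : R), continuous (fun t : R => t *: v + u)}.
  apply: (@cvgD _ _ _ _ _ (fun t => t *: v) (cst u)); last exact: cvg_cst.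
  exact: scalel_continuous.
have : nbhs (0 : R) [set t : R | U (t *: v + u)].
  by apply: cl; rewrite scale0r add0r; exact: open_nbhs_nbhs.
move=> /nbhs_ballP[e e0 eU]; exists e => //; split=> [k|t et].
  exact/(Ck_onS eU)/Ck_on_line.
exact/MPhi/eU.
Qed.

(** A parametrisation and its inverse are replaced by smooth extensions [Phi] and [G] to open sets,
    on domains shrunk until the two are mutually inverse along [M]. *)
Lemma local_chart (M : set 'rV[R]_3) q : smooth_surface M -> M q ->
  exists (U : set 'rV[R]_2) (W : set 'rV[R]_3) (Phi : 'rV[R]_2 -> 'rV[R]_3)
      (G : 'rV[R]_3 -> 'rV[R]_2),
  [/\ open U, smooth_on_open U Phi & forall u, U u -> M (Phi u)] /\
  [/\ open W, W q, differentiable G q,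
      (forall u, U u -> W (Phi u) -> G (Phi u) = u) &
      forall y, M y -> W y -> U (G y) /\ Phi (G y) = y].
Proof.
move=> sM Mq.
have [W0 [U0 [phi [oW0 W0q oU0 [bphi sphi [g sg gK]]]]]] := sM q Mq.
have phiMW u : U0 u -> (M `&` W0) (phi u) by exact: set_bij_homo.
have gphi u : U0 u -> g (phi u) = u by move=> Uu; apply: gK; rewrite inE.
have [u0 U0u0 u0q] := set_bij_surj bphi (conj Mq W0q).
have [U1 [Phi [oU1 U1u0 sPhi Phiphi]]] := sphi u0 U0u0.
have [W1 [G [oW1 W1q sG Gg]]] := sg q (conj Mq W0q).
have PhiE u : U0 u -> U1 u -> Phi u = phi u.
  by move=> ? ?; apply: Phiphi; rewrite inE.
have GE y : M y -> W0 y -> W1 y -> G y = g y.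
  by move=> ? ? ?; apply: Gg; rewrite inE.
have Gq : G q = u0 by rewrite GE// -u0q gphi.
have dG : differentiable G q by have [+ _] := sG 1%N; exact.
(* The preimage under [G] keeps the coordinates where [Phi] agrees with [phi]. Its interior is taken
   to have an open set; continuity of [G] at [q] puts [q] inside. *)
exists (U0 `&` U1), (W0 `&` W1 `&` (G @^-1` (U0 `&` U1))^°), Phi, G; split.
  split; first exact: openI.
  - by move=> k; apply: Ck_onS (sPhi k) => u [].
  - by move=> u [U0u U1u]; rewrite PhiE//; have [] := phiMW u U0u.
split => //.
- by apply: openI; [exact: openI|exact: open_interior].
- split; first by [].
  apply: (differentiable_continuous dG); rewrite Gq.
  by apply: open_nbhs_nbhs; split; [exact: openI|].
- move=> u [U0u U1u] [[W0u W1u] _]; have [Mu _] := phiMW u U0u.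
  by rewrite GE// PhiE// ?gphi//; rewrite -?PhiE.
- move=> y My [[W0y W1y] /interior_subset/= Uy].
  have [u U0u uy] := set_bij_surj bphi (conj My W0y).
  split=> //; have Gy : G y = u by rewrite GE// -uy gphi.
  by move: Uy; rewrite Gy => -[_ U1u]; rewrite PhiE.
Qed.

(** The part of [M] outside a neighbourhood of [x] is compact, so its image is closed, and by
    injectivity it misses [f x]. The curve avoids this image near 0, hence its lift stays in the
    neighbourhood. *)
Lemma pinv_cvg (V W : normedModType R) (M : set V) (S : set W) (f : V -> W)
    (d : W -> V) (c : R -> W) x :
  compact M -> {within M, continuous f} -> set_bij M S f -> M x ->
  c 0 = f x -> {for 0, continuous c} -> (\forall t \near 0, S (c t)) ->
  ('pinv_d M f \o c) @ (0 : R) --> x.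
Proof.
move=> cM cf bf Mx c0 cc Sc A /=; rewrite nbhsE/= => -[B [oB Bx] BA].
pose N := M `&` ~` B.
have cN : compact N by apply: compact_closedI => //; exact: open_closedC.
have clfN : closed (f @` N).
  apply: compact_closed; first exact: norm_hausdorff.
  apply: continuous_compact => //.
  by apply: continuous_subspaceW cf; exact: subIsetl.
have fx : ~ (f @` N) (f x).
  move=> [y [My nBy]] /(set_bij_inj bf); rewrite !inE => /(_ My Mx) yx.
  by apply: nBy; rewrite yx.
have nearfN : \forall t \near (0 : R), (~` (f @` N)) (c t).
  apply: cc; rewrite c0; apply: open_nbhs_nbhs; split => //.
  exact: closed_openC.
suff : \forall t \near (0 : R), A ('pinv_d M f (c t)) by [].
near=> t; apply: BA; apply: contrapT => nB.
have St : S (c t) by near: t.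
have : (~` (f @` N)) (c t) by near: t.
apply; exists ('pinv_d M f (c t)); last first.
  by apply: pinvK; rewrite inE; exact: (set_bij_surj bf).
split=> //; apply: (set_bij_homo (bijpinv_bij d bf)) => //.
Unshelve. all: by end_near. Qed.

Lemma differentiable_mulmxr m n (P : 'M[R]_(m, n)) (w : 'rV[R]_m) :
  differentiable (mulmxr P : 'rV[R]_m -> 'rV[R]_n) w.
Proof.
have -> : (mulmxr P : 'rV[R]_m -> 'rV[R]_n) =
    \sum_(i < m) (fun w : 'rV[R]_m => w 0 i *: row i P).
  by apply/funext => z; rewrite fct_sumE /= mulmx_sum_row.
apply: differentiable_sum => i; apply: differentiableZl.
exact: differentiable_coord.
Qed.

Lemma diff_mulmxr m n (P : 'M[R]_(m, n)) (w v : 'rV[R]_m) :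
  'd (mulmxr P : 'rV[R]_m -> 'rV[R]_n) w v = v *m P.
Proof.
rewrite diff_lin// => z.
exact/differentiable_continuous/differentiable_mulmxr.
Qed.

(** The vector representing [l] is projected to the tangent plane at [p]; this does not change its
    products with velocities of curves on the sphere. *)
Lemma is_gradient_of_linear (F : 'rV[R]_3 -> R) p (l : {linear 'rV[R]_3 -> R}) :
  sphere R p ->
  (forall c, curve_at (sphere R) p c ->
    is_derive (0 : R) 1 (F \o c) (l (velocity c))) ->
  exists v, is_gradient F p v.
Proof.
move=> pp dF; pose v := \row_i l 'e_i.
have lE w : l w = dot v w.
  rewrite [in LHS](row_sum_delta w) linear_sum; apply: eq_bigr => i _.
  by rewrite linearZ mxE mulrC.
exists (v - dot p v *: p); split.
  by apply/(tangent_sphereP _ pp); rewrite dotDr dotNr dotZr pp mulr1 subrr.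
move=> c cc; have : dot p (velocity c) = 0.
  by apply/(tangent_sphereP _ pp); exists c.
by rewrite dotDl dotNl dotZl => ->; rewrite mulr0 subr0 -lE; exact: dF.
Qed.

Lemma differentiable_entry (V : normedModType R) n (X : V -> 'rV[R]_n) x i :
  differentiable X x -> differentiable (fun y => X y 0 i) x.
Proof.
move=> dX.
apply: (@differentiable_comp _ _ _ _ X (fun N : 'rV[R]_n => N 0 i)) => //.
exact: differentiable_coord.
Qed.

Lemma differentiable_scale (V : normedModType R) n (k : V -> R)
    (X : V -> 'rV[R]_n) x :
  differentiable k x -> differentiable X x ->
  differentiable (fun y => k y *: X y) x.
Proof.
move=> dk dX; have -> : (fun y => k y *: X y) =
    \sum_(i < n) (fun y => (k y * X y 0 i) *: ('e_i : 'rV[R]_n)).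
  apply/funext => y; rewrite fct_sumE [in LHS](row_sum_delta (X y)) scaler_sumr.
  by apply: eq_bigr => i _; rewrite scalerA.
apply: differentiable_sum => i; apply: differentiableZl.
exact/differentiableM/differentiable_entry.
Qed.

Lemma differentiable_dotself (V : normedModType R) (X : V -> 'rV[R]_3) x :
  differentiable X x -> differentiable (fun y => dot (X y) (X y)) x.
Proof.
move=> dX; have -> : (fun y => dot (X y) (X y)) =
    \sum_(i < 3) (fun y => X y 0 i * X y 0 i).
  by apply/funext => z; rewrite fct_sumE.
apply: differentiable_sum => i.
by apply: differentiableM; exact: differentiable_entry.
Qed.

Lemma differentiable_ln (V : normedModType R) (k : V -> R) x :
  differentiable k x -> 0 < k x -> differentiable (fun y => ln (k y)) x.
Proof.
move=> dk k0; apply: (@differentiable_comp _ _ _ _ k (@ln R)) => //.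
by apply/derivable1_diffP; have [] := is_derive1_ln k0.
Qed.

Lemma conformal_factor_chart (M : set 'rV[R]_3) f h (U : set 'rV[R]_2)
    (W : set 'rV[R]_3) (Phi : 'rV[R]_2 -> 'rV[R]_3) (F : 'rV[R]_3 -> 'rV[R]_3)
    (u0 v : 'rV[R]_2) :
  conformal_factor M f h -> open U -> smooth_on_open U Phi ->
  (forall u, U u -> M (Phi u)) -> open W -> smooth_on_open W F ->
  {in M `&` W, F =1 f} -> U u0 -> W (Phi u0) -> 'D_v Phi u0 != 0 ->
  exists2 K : 'rV[R]_2 -> R, differentiable K u0 &
    \forall u \near u0, ln (h (Phi u)) = K u.
Proof.
move=> fh oU sPhi MPhi oW sF Ff Uu0 Wu0 X0.
pose X u := 'D_v Phi u.
(* [Y u] is the differential of [F] applied to [X u], expanded in the partial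
   derivatives of [F] so that it is visibly differentiable in [u]. *)
pose Y u := \sum_(i < 3) X u 0 i *: 'D_('e_i) F (Phi u).
have dPhi u : U u -> differentiable Phi u by have [+ _] := sPhi 1%N; exact.
have dF y : W y -> differentiable F y by have [+ _] := sF 1%N; exact.
have dX u : U u -> differentiable X u.
  by have [_ /(_ v)[+ _]] := sPhi 2%N; exact.
have dY : differentiable Y u0.
  have -> : Y = \sum_(i < 3) (fun u => X u 0 i *: 'D_('e_i) F (Phi u)).
    by apply/funext => u; rewrite fct_sumE.
  apply: differentiable_sum => i; apply: differentiable_scale.
    exact/differentiable_entry/dX.
  apply: (@differentiable_comp _ _ _ _ Phi ('D_('e_i) F)); first exact: dPhi.
  by have [_ /(_ 'e_i)[+ _]] := sF 2%N; exact.
have YE u : U u -> W (Phi u) -> differential M f (Phi u) (X u) = Y u.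
  move=> Uu Wu; rewrite (differential_ext oW Wu (dF _ Wu) Ff).
    rewrite [in LHS](row_sum_delta (X u)) linear_sum; apply: eq_bigr => i _.
    by rewrite linearZ deriveE//; exact: dF.
  exact: (tangent_chart _ oU Uu sPhi MPhi).
have XY u : U u -> W (Phi u) -> 0 < h (Phi u) /\
    dot (X u) (X u) = h (Phi u) ^+ 2 * dot (Y u) (Y u).
  move=> Uu Wu; have [h0 hE] := fh _ (MPhi _ Uu); split=> //.
  have tX := tangent_chart v oU Uu sPhi MPhi.
  by rewrite (hE _ _ tX tX) YE.
have Y0 : 0 < dot (Y u0) (Y u0).
  have [h0 hE] := XY _ Uu0 Wu0.
  by rewrite -(pmulr_rgt0 _ (exprn_gt0 2 h0)) -hE dot_gt0.
have cY := differentiable_continuous (differentiable_dotself dY).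
(* The logarithm of [|X|^2 = h^2 |Y|^2] solved for [ln h]; both lengths are positive at [u0]. *)
exists (fun u => 2^-1 * (ln (dot (X u) (X u)) - ln (dot (Y u) (Y u)))).
  apply: differentiableZ; apply: differentiableB.
    apply: differentiable_ln; first exact/differentiable_dotself/dX.
    by rewrite dot_gt0.
  by apply: differentiable_ln => //; exact: differentiable_dotself.
near=> u.
have Uu : U u by near: u; exact: open_nbhs_nbhs.
have Wu : W (Phi u).
  near: u; apply: (differentiable_continuous (dPhi _ Uu0)).
  exact: open_nbhs_nbhs.
have Yu : 0 < dot (Y u) (Y u). by near: u; exact: (cvgr_gt _ cY _ Y0).
have [hu ->] := XY u Uu Wu.
rewrite lnM ?posrE// ?exprn_gt0// lnXn// addrK.
by move: (ln _) => l; field.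
Unshelve. all: by end_near. Qed.

Lemma ln_conformal_factor_gradient (M : set 'rV[R]_3) f h x :
  closed_surface M -> conformal_map M f -> conformal_factor M f h -> M x ->
  exists v, is_gradient (fun y => ln (on_sphere M f h y)) (f x) v.
Proof.
move=> [sM cM] [sf bf _] fh Mx.
have [U [W [Phi [G [[oU sPhi MPhi] [oW Wx dG GPhi PhiG]]]]]] :=
  local_chart sM Mx.
have [W2 [F [oW2 W2x sF Ff]]] := sf x Mx.
pose u0 := G x; have [Uu0 Phiu0] := PhiG x Mx Wx.
have FE y : M y -> W2 y -> F y = f y by move=> ? ?; apply: Ff; rewrite inE.
have dPhi : differentiable Phi u0 by have [+ _] := sPhi 1%N; exact.
have dF : differentiable F (Phi u0).
  by rewrite Phiu0; have [+ _] := sF 1%N; exact.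
have sfx : sphere R (f x) by exact: (set_bij_homo bf).
(* The chart is an immersion because it has a differentiable left inverse. *)
have Phi_inj v : v != 0 -> 'D_v Phi u0 != 0.
  apply: contra_neq => dv0.
  have dG' : differentiable G (Phi u0) by rewrite Phiu0.
  have : 'D_v (G \o Phi) u0 = 'D_v id u0.
    apply: near_eq_derive; near=> u; apply: GPhi.
      by near: u; exact: open_nbhs_nbhs.
    near: u; apply: (differentiable_continuous dPhi).
    by rewrite Phiu0; exact: open_nbhs_nbhs.
  rewrite derive_id => <-.
  rewrite deriveE; last exact: differentiable_comp.
  by rewrite diff_comp//= -(deriveE _ dPhi) dv0 linear0.
pose A := jacobian (F \o Phi) u0.
have dFPhi : differentiable (F \o Phi) u0 by exact: differentiable_comp.
have AE v : v *m A = 'd F (Phi u0) ('D_v Phi u0).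
  by rewrite -deriveEjacobian// deriveE// diff_comp//= deriveE.
(* Conformality makes the squared length of ['D_v Phi u0] a multiple of that of [v *m A], so a
   kernel vector of [A] would contradict the immersion property. *)
have freeA : row_free A.
  apply: inj_row_free => v /eqP vA; apply/eqP; apply: contraTT vA => v0.
  have tX := tangent_chart v oU Uu0 sPhi MPhi.
  have [_ /(_ _ _ tX tX)] := fh _ (MPhi _ Uu0).
  have W2u0 : W2 (Phi u0) by rewrite Phiu0.
  rewrite (differential_ext oW2 W2u0 dF Ff tX) -AE => E.
  have := Phi_inj _ v0; rewrite -dot_gt0 E; apply: contraTneq => ->.
  by rewrite dot0l mulr0 ltxx.
(* With row vectors, [P] inverts [A] on the right, so composing [F \o Phi] with it gives a map whose
   differential at [u0] is the identity. *)
pose P := pinvmx A.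
pose Psi := (mulmxr P : 'rV[R]_3 -> 'rV[R]_2) \o (F \o Phi).
have dPsi : is_diff u0 Psi id.
  have dP := differentiable_mulmxr P ((F \o Phi) u0).
  split; first exact: differentiable_comp.
  apply/funext => v; rewrite diff_comp//= diff_mulmxr -deriveE//.
  by rewrite deriveEjacobian// -mulmxA mulmxVp// mulmx1.
have e0 : (delta_mx 0 0 : 'rV[R]_2) != 0.
  by apply/eqP => /rowP/(_ 0); rewrite !mxE/= => /eqP; rewrite oner_eq0.
have W2u0 : W2 (Phi u0) by rewrite Phiu0.
have [K dK hK] := conformal_factor_chart fh oU sPhi MPhi oW2 sF Ff Uu0 W2u0
  (Phi_inj _ e0).
(* The linear form sends a velocity on the sphere to chart coordinates by [P] and then applies the
   differential of [K]. *)
apply: (@is_gradient_of_linear _ _ ('d K u0 \o mulmxr P)) => // c cc.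
have [c0 _] := cc; have dc := curve_at_derive cc.
have cc0 : {for 0, continuous c}.
  by apply/differentiable_continuous/derivable1_diffP; have [] := dc.
pose y := 'pinv_(fun=> 0) M f \o c.
have y0 : y 0 = x.
  by rewrite /y /= c0; apply: pinvKV; [exact: set_bij_inj bf|rewrite inE].
have ycvg : y @ (0 : R) --> x.
  exact: (pinv_cvg (fun=> 0) cM (smooth_on_continuous sf) bf Mx c0 cc0
    (curve_at_near cc)).
pose u := G \o y.
have Uu0' : u 0 = u0 by rewrite /u /= y0.
have cu : {for 0, continuous u}.
  apply: (@cvg_comp _ _ _ y G _ (nbhs x)) => //.
  by rewrite Uu0'; exact: (differentiable_continuous dG).
have near_y : \forall t \near (0 : R), [/\ M (y t), f (y t) = c t,
    W2 (y t) & Phi (u t) = y t].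
  near=> t.
  have St : sphere R (c t) by near: t; exact: curve_at_near cc.
  have Mt : M (y t) by exact: (set_bij_homo (bijpinv_bij _ bf)).
  have Wt : W (y t) by near: t; apply: ycvg; exact: open_nbhs_nbhs.
  split=> //.
  - by apply: pinvK; rewrite inE; exact: (set_bij_surj bf).
  - by near: t; apply: ycvg; exact: open_nbhs_nbhs.
  - by have [] := PhiG _ Mt Wt.
(* Near 0, [F (Phi (u t)) = f (y t) = c t], so [Psi \o u] is [c] followed by the linear map [P]. Its
   derivative is therefore known before that of [u]. *)
have dPu : is_derive (0 : R) 1 (Psi \o u) (velocity c *m P).
  have dP := differentiable_mulmxr P (c 0).
  have := is_derive_comp_curve dP dc; rewrite diff_mulmxr.
  apply: near_eq_is_derive; apply: filterS near_y => t [Mt ft Wt Pt] /=.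
  by rewrite /Psi /= Pt FE// ft.
have dPsi' : is_diff (u 0) Psi id by rewrite Uu0'.
have du := is_derive_of_comp dPsi' cu dPu.
have dKu : differentiable K (u 0) by rewrite Uu0'.
have := is_derive_comp_curve dKu du; rewrite Uu0'.
have hKu : \forall t \near (0 : R), ln (h (Phi (u t))) = K (u t).
  have hK0 : \forall z \near u 0, ln (h (Phi z)) = K z by rewrite Uu0'.
  exact: (cu _ hK0).
apply: near_eq_is_derive; near=> t.
have [Mt ft Wt Pt] : [/\ M (y t), f (y t) = c t, W2 (y t) & Phi (u t) = y t].
  by near: t.
have hKt : ln (h (Phi (u t))) = K (u t) by near: t.
by rewrite /= /on_sphere /= -hKt Pt.
Unshelve. all: by end_near. Qed.

End ConformalFactor.

(** * The Hamiltonian with a passive vortex and the velocity formula *)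

Section FluidVelocity.
Variable R : realType.

Lemma is_gradientZ F (p v : 'rV[R]_3) (a : R) : sphere R p ->
  is_gradient F p v -> is_gradient (fun x => a * F x) p (a *: v).
Proof.
move=> pp gF; have := is_gradient_lin 0 a 0 pp gF gF.
rewrite scale0r addr0; congr (is_gradient _ p _).
by apply/funext => x; rewrite add0r mul0r addr0.
Qed.

Lemma poly_ext (P Q : {poly R}) : (forall a, P.[a] = Q.[a]) -> P = Q.
Proof.
move=> PQ; apply/eqP; rewrite -subr_eq0.
(* In characteristic zero these are as many distinct roots of the difference as its size, one more
   than the degree of a nonzero polynomial. *)
pose s := [seq i%:R : R | i <- iota 0 (size (P - Q))].
apply/eqP; apply: (@roots_geq_poly_eq0 _ _ s).
- by apply/allP => a _; rewrite rootE !hornerE PQ subrr.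
- rewrite map_inj_uniq ?iota_uniq// => i j /eqP.
  by rewrite eqr_nat => /eqP.
- by rewrite size_map size_iota.
Qed.

Lemma append_widen (T : Type) n (s : 'I_n -> T) x (i : 'I_n) :
  append s x (widen_ord (leqnSn n) i) = s i.
Proof.
have -> : widen_ord (leqnSn n) i = lift ord_max i.
  by apply: val_inj; rewrite /= /bump leqNgt ltn_ord.
by rewrite /append liftK.
Qed.

Lemma append_max (T : Type) n (s : 'I_n -> T) x : append s x ord_max = x.
Proof. by rewrite /append unlift_none. Qed.

Lemma dfwith_append (T : Type) n (s : 'I_n -> T) x y :
  dfwith (append s x) ord_max y = append s y.
Proof.
apply/funext => i; case: dfwithP => [|j jmax]; first by rewrite append_max.
by rewrite /append; case: unliftP jmax => [k _|->] //; rewrite eqxx.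
Qed.

Lemma hamiltonian_append (h : 'rV[R]_3 -> R) n (w : 'I_n -> R)
    (p : 'I_n -> 'rV[R]_3) (a : R) (y : 'rV[R]_3) :
  hamiltonian h (append w a) (append p y) =
  hamiltonian h w p + - a * (\sum_(i < n) w i * green (p i) y) +
  - ((4 * pi)^-1 * a ^+ 2) * ln (h y).
Proof.
(* The added vortex has the largest index: as the first member of a pair it contributes an empty
   sum, so it occurs only as the second argument of [green]. *)
rewrite /hamiltonian big_ord_recr [X in - (_ + X)]big1 => [|j]; last first.
  by rewrite ltnNge -ltnS ltn_ord.
under eq_bigr => i _.
  rewrite big_mkcond big_ord_recr /= ltn_ord -big_mkcond.
  rewrite !append_widen !append_max.
  under eq_bigr do rewrite !append_widen.
  over.
rewrite big_split /= [X in _ - _ * X]big_ord_recr /= !append_max.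
under [X in _ - _ * (X + _)]eq_bigr do rewrite !append_widen.
have -> : \sum_(i < n) w i * a * green (p i) y =
    a * \sum_(i < n) w i * green (p i) y.
  by rewrite big_distrr; apply: eq_bigr => i _ /=; ring.
by ring.
Qed.

Lemma is_gradient_hamiltonian (h : 'rV[R]_3 -> R) n (w : 'I_n -> R)
    (p : 'I_n -> 'rV[R]_3) (a : R) (x g : 'rV[R]_3) :
  (forall i, sphere R (p i)) -> sphere R x -> (forall i, x != p i) ->
  is_gradient (fun y => ln (h y)) x g ->
  is_gradient (fun y => hamiltonian h (append w a) (append p y)) x
    (- a *: (\sum_(i < n) (w i / (4 * pi * (1 - dot x (p i)))) *:
       (p i - dot x (p i) *: x)) + - ((4 * pi)^-1 * a ^+ 2) *: g).
Proof.
move=> sp sx xp gh.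
have -> : (fun y => hamiltonian h (append w a) (append p y)) =
    (fun y => hamiltonian h w p + - a * (\sum_(i < n) w i * green (p i) y) +
       - ((4 * pi)^-1 * a ^+ 2) * ln (h y)).
  by apply/funext => y; exact: hamiltonian_append.
apply: is_gradient_lin => //; apply: is_gradient_sum => // i.
by rewrite -scalerA; apply: is_gradientZ => //; exact: is_gradient_green.
Qed.

(** For strength [a] the symplectic gradient is [a *: (- T - a *: S)], where [S] stems from [ln h].
    Hence [Q] has the value [- T] at [a = 0], and the velocity is [T]. *)
Lemma fluid_velocityP (h : 'rV[R]_3 -> R) n (w : 'I_n -> R)
    (p : 'I_n -> 'rV[R]_3) (x g u : 'rV[R]_3) :
  (forall i, sphere R (p i)) -> sphere R x -> (forall i, x != p i) ->
  is_gradient (fun y => ln (h y)) x g ->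
  is_fluid_velocity h w p x u <->
  u = (4 * pi * h x ^+ 2)^-1 *:
      \sum_(i < n) (w i / (1 - dot x (p i))) *: cross x (p i).
Proof.
move=> sp sx xp gh.
set T := (RHS in _ <-> u = RHS).
pose S := ((h x ^+ 2)^-1 * (4 * pi)^-1) *: cross x g.
pose grad a := - a *: (\sum_(i < n) (w i / (4 * pi * (1 - dot x (p i)))) *:
       (p i - dot x (p i) *: x)) + - ((4 * pi)^-1 * a ^+ 2) *: g.
have gradE a : (h x ^+ 2)^-1 *: cross x (grad a) = a *: (- T - a *: S).
  have crossE : cross x (\sum_(i < n) (w i / (4 * pi * (1 - dot x (p i)))) *:
       (p i - dot x (p i) *: x)) =
      (4 * pi)^-1 *: \sum_(i < n) (w i / (1 - dot x (p i))) *: cross x (p i).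
    rewrite cross_sum scaler_sumr; apply: eq_bigr => i _.
    (* The component of the gradient along [x] disappears in the cross product with [x]. *)
    rewrite crossZ crossD crossN crossZ crossvv scaler0 subr0 scalerA invfM.
    by congr (_ *: _); rewrite mulrCA.
  rewrite /grad crossD !crossZ crossE /T /S (invfM (4 * pi)).
  move: (\sum_(i < n) _) (cross x g) (h x ^- 2) ((4 * pi)^-1) => Z Y b d.
  by apply/rowP => i; rewrite !mxE; ring.
have gH a : is_gradient (fun y => hamiltonian h (dfwith (append w 0) ord_max a)
    (dfwith (append p x) ord_max y)) x (grad a).
  under eq_fun do rewrite !dfwith_append.
  exact: is_gradient_hamiltonian.
clearbody T S; split=> [[Q QE ->]|->].
  have QE' i : Q 0 i = (- T 0 i)%:P - (S 0 i) *: 'X.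
    (* The identity for [a * Q(a)] says nothing about [Q] at [a = 0]; it is read as an identity of
       polynomials, where the factor ['X] can be cancelled. *)
    apply: (@mulfI _ 'X); first by rewrite polyX_eq0.
    apply: poly_ext => a; rewrite !hornerE.
    have [v [v' gv vE] sE] := QE a.
    rewrite append_max in gv vE sE.
    have := sE; rewrite vE (gradient_unique sx gv (gH a)) gradE.
    move=> /rowP/(_ i); rewrite !mxE => ->; ring.
  rewrite append_max; apply/rowP => i; rewrite !mxE QE' !hornerE; ring.
exists (\row_i ((- T 0 i)%:P - (S 0 i) *: 'X)); last first.
  by rewrite append_max; apply/rowP => i; rewrite !mxE !hornerE; ring.
move=> a; rewrite append_max.
exists (cross x (grad a)); first by exists (grad a).
by rewrite gradE; apply/rowP => i; rewrite !mxE !hornerE; ring.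
Qed.

End FluidVelocity.

Unset Implicit Arguments.

Theorem theorem51 (R : realType) (M : set 'rV[R]_3)
    (f : 'rV[R]_3 -> 'rV[R]_3) (h : 'rV[R]_3 -> R)
    (n : nat) (w : 'I_n -> R) (q : 'I_n -> 'rV[R]_3) (x : 'rV[R]_3) :
  closed_surface M -> genus_zero M ->
  conformal_map M f -> conformal_factor M f h ->
  (forall i : 'I_n, M (q i)) -> injective q ->
  \sum_(i < n) w i = 0 ->
  M x -> (forall i : 'I_n, x <> q i) ->
  let hS := on_sphere M f h in
  let p := f x in
  forall u : 'rV[R]_3,
    is_fluid_velocity hS w (fun i => f (q i)) p u <->
    u = (4%:R * pi * hS p ^+ 2)^-1 *:
        \sum_(i < n) (w i / (1 - dot p (f (q i)))) *: cross p (f (q i)).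
Proof.
move=> cM _ cf fh Mq _ _ Mx xq hS p u.
have [_ bf _] := cf.
have sf y : M y -> sphere R (f y) by exact: (set_bij_homo bf).
have [g gh] := ln_conformal_factor_gradient cM cf fh Mx.
apply: (@fluid_velocityP R hS n w (f \o q) p g u) => // [i||i].
- exact/sf/Mq.
- exact: sf.
(* Injectivity of [f] keeps the image of [x] apart from the images of the vortices. *)
- apply/eqP => /(set_bij_inj bf); rewrite !inE => /(_ Mx (Mq i)).
  exact: xq.
Qed.
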